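(* Let $v,w$, $a,b,c$, $B,C$ be as in the context, suppose $\xi:=cC+ibB\neq0$, and write $\xi=re^{i\theta}$ for $r>0$ and $\theta\in\mathbb{R}$. Define functions $f,h:\mathbb{R}^2\to\mathbb{R}$ and $g:\mathbb{R}^2\to\mathbb{C}$ by $$f=a+bv+cw,\quad g=\frac{1}{2f^{1/2}}\Bigl(-b\frac{dv}{ds}+ic\frac{dw}{dt}\Bigr),\quad h=\frac{1}{12f}\Bigl(-b\frac{d^2v}{ds^2}+c\frac{d^2w}{dt^2}\Bigr),$$ and let $\tau=\sum_{n=-2}^2\lambda^n\tau_n$, where $$\tau_2=ie^{2i\theta/3}\begin{pmatrix} 0 & r f^{-1/2} & 0 \\ 0 & 0 & f \\ r f^{-1/2} & 0 & 0 \end{pmatrix},\quad \tau_1=ie^{i\theta/3}\begin{pmatrix} 0 & 0 & g \\ -g & 0 & 0 \\ 0 & 0 & 0 \end{pmatrix},\quad \tau_0=i\begin{pmatrix} 2h & 0 & 0 \\ 0 & -h & 0 \\ 0 & 0 & -h \end{pmatrix},$$ $$\tau_{-1}=ie^{-i\theta/3}\begin{pmatrix} 0 & -\bar g & 0 \\ 0 & 0 & 0 \\ \bar g & 0 & 0 \end{pmatrix},\quad \tau_{-2}=ie^{-2i\theta/3}\begin{pmatrix} 0 & 0 & r f^{-1/2} \\ r f^{-1/2} & 0 & 0 \\ 0 & f & 0 \end{pmatrix}.$$ Then $\tau$ is a real polynomial Killing field (for the loop of connections $d+\alpha_\lambda$ given in the context).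
   Context: Setting. Fix $\theta_0\in[0,2\pi)$ and set $\beta_1=\frac1{\sqrt2}\cos\theta_0-\frac1{\sqrt6}\sin\theta_0$, $\beta_2=-\frac1{\sqrt2}\cos\theta_0-\frac1{\sqrt6}\sin\theta_0$, $\beta_3=\frac2{\sqrt6}\sin\theta_0$, $\gamma_1=-\frac1{\sqrt6}\cos\theta_0-\frac1{\sqrt2}\sin\theta_0$, $\gamma_2=-\frac1{\sqrt6}\cos\theta_0+\frac1{\sqrt2}\sin\theta_0$, $\gamma_3=\frac2{\sqrt6}\cos\theta_0$. Let $y_1,y_2,y_3:\mathbb{R}\to\mathbb{C}$, $v:\mathbb{R}\to\mathbb{R}$ (functions of $s$) and $z_1,z_2,z_3:\mathbb{R}\to\mathbb{C}$, $w:\mathbb{R}\to\mathbb{R}$ (functions of $t$) satisfy, for all $s,t$: $\frac{dy_1}{ds}=\beta_1\overline{y_2y_3}$, $\frac{dy_2}{ds}=\beta_2\overline{y_3y_1}$, $\frac{dy_3}{ds}=\beta_3\overline{y_1y_2}$, $|y_j|^2=\beta_jv+1$; $\frac{dz_1}{dt}=\gamma_1\overline{z_2z_3}$, $\frac{dz_2}{dt}=\gamma_2\overline{z_3z_1}$, $\frac{dz_3}{dt}=\gamma_3\overline{z_1z_2}$, $|z_j|^2=\gamma_jw+1$. Then $\operatorname{Im}(y_1y_2y_3)\equiv B$ and $\operatorname{Im}(z_1z_2z_3)\equiv C$ for constants $B,C\in[-1,1]$. Set $a=\frac16$, $b=-\frac12\beta_1\beta_2\beta_3$, $c=-\frac12\gamma_1\gamma_2\gamma_3$.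 When $\xi=cC+ibB\ne0$, $f=a+bv+cw$ is everywhere positive on $\mathbb{R}^2$. Loop of flat connections. Write $\xi=re^{i\theta}$ with $r=|\xi|>0$, and use the complex coordinate $z=\xi^{1/3}(s+it)$ on $\mathbb{R}^2$ with $\xi^{1/3}=r^{1/3}e^{i\theta/3}$, so that $\frac{\partial}{\partial z}=\frac{1}{2r^{1/3}e^{i\theta/3}}\bigl(\frac{\partial}{\partial s}-i\frac{\partial}{\partial t}\bigr)$ and $\frac{\partial}{\partial\bar z}=\frac{1}{2r^{1/3}e^{-i\theta/3}}\bigl(\frac{\partial}{\partial s}+i\frac{\partial}{\partial t}\bigr)$. For $\lambda\in\mathbb{C}^*=\mathbb{C}\setminus\{0\}$ set $\alpha_\lambda=(\alpha_1'\lambda+\alpha_0')dz+(\alpha_{-1}''\lambda^{-1}+\alpha_0'')d\bar z$, where $$\alpha_1'=r^{-1/3}\begin{pmatrix} 0 & 0 & f^{1/2} \\ f^{1/2} & 0 & 0 \\ 0 & r f^{-1} & 0 \end{pmatrix},\quad \alpha_0'=\tfrac12\begin{pmatrix} 0 & 0 & 0 \\ 0 & \frac{\partial}{\partial z}(\log f) & 0 \\ 0 & 0 & -\frac{\partial}{\partial z}(\log f) \end{pmatrix},$$ $$\alpha_{-1}''=-r^{-1/3}\begin{pmatrix} 0 & f^{1/2} & 0 \\ 0 & 0 & r f^{-1} \\ f^{1/2} & 0 & 0 \end{pmatrix},\quad \alpha_0''=\tfrac12\begin{pmatrix} 0 & 0 & 0 \\ 0 & -\frac{\partial}{\partial\bar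 z}(\log f) & 0 \\ 0 & 0 & \frac{\partial}{\partial\bar z}(\log f) \end{pmatrix}.$$ Polynomial Killing fields. Let $\zeta=e^{2\pi i/3}$ and $\Upsilon=\mathrm{diag}(1,\zeta,\zeta^2)$. For $d\in\mathbb{N}$ let $\Lambda_d\mathfrak{gl}(3,\mathbb{C})$ be the vector space of maps $\eta:\mathbb{C}^*\to\mathfrak{gl}(3,\mathbb{C})$ of the form $\eta(\lambda)=\sum_{n=-d}^d\eta_n\lambda^n$, $\eta_n\in\mathfrak{gl}(3,\mathbb{C})$, with $\eta(\zeta\lambda)=\Upsilon\eta(\lambda)\Upsilon^{-1}$ for all $\lambda\in\mathbb{C}^*$, and let $\Lambda_d\mathfrak{u}(3)$ be the real subspace of $\eta$ such that $\eta(\lambda)\in\mathfrak{u}(3)$ (skew-Hermitian) whenever $|\lambda|=1$. A polynomial Killing field is a smooth map $\eta:\mathbb{R}^2\to\Lambda_d\mathfrak{gl}(3,\mathbb{C})$ for some $d\in\mathbb{N}$ satisfying $d\eta=[\eta,\alpha_\lambda]$ (for all $\lambda\in\mathbb{C}^*$, with $d$ here the exterior derivative on $\mathbb{R}^2$). It is real if it takes values in $\Lambda_d\mathfrak{u}(3)$. *)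

(* Defs.v *)
From HB Require Import structures.
From mathcomp Require Import all_boot all_order all_algebra.
From mathcomp Require Import complex.
From mathcomp Require Import all_classical all_reals all_analysis.

Set Implicit Arguments.
Unset Strict Implicit.
Unset Printing Implicit Defensive.

Import Order.TTheory GRing.Theory Num.Theory.
Import numFieldNormedType.Exports.

Local Open Scope classical_set_scope.
Local Open Scope ring_scope.
Local Open Scope complex_scope.

(* Throughout, the indices 1, 2, 3 are the elements 0, 1, 2 of 'I_3. *)

Section ComplexDerivatives.
Variable R : realType.

Definition expi (x : R) : R[i] := cos x +i* sin x.

(* R[i] has no normed R-module instance, so the derivative of a
   complex-valued function of a real variable is taken on the real and
   imaginary parts. *)
Definition is_cderive (F : R -> R[i]) (x : R) (l : R[i]) : Prop :=
  is_derive x 1 (fun u => complex.Re (F u)) (complex.Re l) /\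
  is_derive x 1 (fun u => complex.Im (F u)) (complex.Im l).

Definition cderive1 (F : R -> R[i]) (x : R) : R[i] :=
  derive1 (fun u => complex.Re (F u)) x +i* derive1 (fun u => complex.Im (F u)) x.

Definition mxderive1 m n (F : R -> 'M[R[i]]_(m, n)) (x : R) : 'M[R[i]]_(m, n) :=
  \matrix_(i, j) cderive1 (fun u => F u i j) x.

Definition partial_s (u : R -> R -> R) (s t : R) : R := derive1 (fun s' => u s' t) s.
Definition partial_t (u : R -> R -> R) (s t : R) : R := derive1 (fun t' => u s t') t.

Fixpoint class_C (n : nat) (u : R -> R -> R) : Prop :=
  continuous (fun p : R * R => u p.1 p.2) /\
  if n is m.+1 then
    [/\ forall s t, derivable (fun s' => u s' t) s 1,
        forall s t, derivable (fun t' => u s t') t 1,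
        class_C m (partial_s u) & class_C m (partial_t u)]
  else True.

Definition smooth (u : R -> R -> R) : Prop := forall n, class_C n u.

Definition mxsmooth m n (F : R -> R -> 'M[R[i]]_(m, n)) : Prop :=
  forall i j, smooth (fun s t => complex.Re (F s t i j)) /\
              smooth (fun s t => complex.Im (F s t i j)).

End ComplexDerivatives.

Section Setting.
Variable R : realType.

Definition beta (theta0 : R) : 'I_3 -> R := tnth [tuple
  (Num.sqrt 2)^-1 * cos theta0 - (Num.sqrt 6)^-1 * sin theta0;
  - ((Num.sqrt 2)^-1 * cos theta0) - (Num.sqrt 6)^-1 * sin theta0;
  2 / Num.sqrt 6 * sin theta0].

Definition gamma (theta0 : R) : 'I_3 -> R := tnth [tuple
  - ((Num.sqrt 6)^-1 * cos theta0) - (Num.sqrt 2)^-1 * sin theta0;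
  - ((Num.sqrt 6)^-1 * cos theta0) + (Num.sqrt 2)^-1 * sin theta0;
  2 / Num.sqrt 6 * cos theta0].

(* Index arithmetic in 'I_3 is modulo 3, so (j, j + 1, j + 2) runs through the
   cyclic permutations of the three indices. *)
Definition evolution (k : 'I_3 -> R) (y : 'I_3 -> R -> R[i]) (v : R -> R) : Prop :=
  forall (j : 'I_3) (s : R),
    is_cderive (y j) s ((k j)%:C * (y (j + 1) s * y (j + 2) s)^*) /\
    `|y j s| ^+ 2 = (k j * v s + 1)%:C.

End Setting.

Section Loops.
Variable R : realType.
Local Notation C := R[i].
Local Notation gl3 := 'M[C]_3.

Definition mx3 (a11 a12 a13 a21 a22 a23 a31 a32 a33 : C) : gl3 :=
  \matrix_(i, j) nth 0 (nth [::] [:: [:: a11; a12; a13];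
                                     [:: a21; a22; a23];
                                     [:: a31; a32; a33]] i) j.

Section Connection.
Variables (r theta : R) (f : R -> R -> R).

(* xi = r e^(i theta) *)
Definition cbrt_xi : C := (r `^ 3^-1)%:C * expi (theta / 3).

Definition dz (X : R * R) : C := cbrt_xi * (X.1 +i* X.2).
Definition dzbar (X : R * R) : C := (cbrt_xi)^* * (X.1 -i* X.2).

Definition partial_z (u : R -> R -> R) (s t : R) : C :=
  (2 * cbrt_xi)^-1 * (partial_s u s t -i* partial_t u s t).
Definition partial_zbar (u : R -> R -> R) (s t : R) : C :=
  (2 * (cbrt_xi)^*)^-1 * (partial_s u s t +i* partial_t u s t).

Definition log_f (s t : R) : R := ln (f s t).

Definition alpha1' (s t : R) : gl3 :=
  let q := (Num.sqrt (f s t))%:C in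
  ((r `^ 3^-1)^-1)%:C *: mx3 0 0 q
                             q 0 0
                             0 (r / f s t)%:C 0.

Definition alpha0' (s t : R) : gl3 :=
  let l := partial_z log_f s t in
  2^-1 *: mx3 0 0 0
              0 l 0
              0 0 (- l).

Definition alpham1'' (s t : R) : gl3 :=
  let q := (Num.sqrt (f s t))%:C in
  - ((r `^ 3^-1)^-1)%:C *: mx3 0 q 0
                               0 0 (r / f s t)%:C
                               q 0 0.

Definition alpha0'' (s t : R) : gl3 :=
  let l := partial_zbar log_f s t in
  2^-1 *: mx3 0 0 0
              0 (- l) 0
              0 0 l.

(* A matrix-valued 1-form on R^2 is a function of a point (s, t) and of a
   tangent vector X = X.1 d/ds + X.2 d/dt. *)
Definition alpha (lambda : C) (s t : R) (X : R * R) : gl3 :=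
  dz X *: (lambda *: alpha1' s t + alpha0' s t) +
  dzbar X *: (lambda^-1 *: alpham1'' s t + alpha0'' s t).

End Connection.

(* Loops C^* -> gl(3,C) are total functions on C; their value at 0 is
   irrelevant. *)
Definition loop := C -> gl3.

(* The coefficient of lambda^n, -d <= n <= d, is stored at index n + d. *)
Definition laurent (d : nat) (c : 'I_(2 * d).+1 -> gl3) : loop :=
  fun lambda => \sum_(k < (2 * d).+1) lambda ^ (k%:Z - d%:Z) *: c k.

Definition zeta : C := expi (2 * pi / 3).
Definition Upsilon : gl3 := diag_mx (\row_(j < 3) zeta ^+ j).

Definition twisted (eta : loop) : Prop :=
  forall lambda, lambda != 0 ->
    eta (zeta * lambda) = Upsilon *m eta lambda *m invmx Upsilon.

Definition in_Lambda_gl (d : nat) (eta : loop) : Prop :=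
  (exists c : 'I_(2 * d).+1 -> gl3,
     forall lambda, lambda != 0 -> eta lambda = laurent c lambda) /\
  twisted eta.

Definition skew_hermitian (A : gl3) : Prop := (map_mx (@conjc R) A)^T = - A.

Definition in_Lambda_u (d : nat) (eta : loop) : Prop :=
  in_Lambda_gl d eta /\
  forall lambda, `|lambda| = 1 -> skew_hermitian (eta lambda).

(* The finite-dimensional space Lambda_d gl(3,C) is embedded in the space of
   coefficient families, and a map into it is smooth when its coefficients
   are. *)
Definition smooth_in_Lambda_gl (d : nat) (eta : R -> R -> loop) : Prop :=
  (forall s t, in_Lambda_gl d (eta s t)) /\
  exists2 c : 'I_(2 * d).+1 -> R -> R -> gl3,
    forall k, mxsmooth (c k) &
    forall s t lambda, lambda != 0 ->
      eta s t lambda = laurent (fun k => c k s t) lambda.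

Definition ext_d (F : R -> R -> gl3) (s t : R) (X : R * R) : gl3 :=
  X.1%:C *: mxderive1 (fun s' => F s' t) s +
  X.2%:C *: mxderive1 (fun t' => F s t') t.

Definition Killing_field (r theta : R) (f : R -> R -> R) (d : nat)
    (eta : R -> R -> loop) : Prop :=
  smooth_in_Lambda_gl d eta /\
  forall lambda, lambda != 0 -> forall s t X,
    let A := alpha r theta f lambda s t X in
    ext_d (fun s' t' => eta s' t' lambda) s t X =
    eta s t lambda *m A - A *m eta s t lambda.

Definition polynomial_Killing_field (r theta : R) (f : R -> R -> R)
    (eta : R -> R -> loop) : Prop :=
  exists d, Killing_field r theta f d eta.

Definition real_polynomial_Killing_field (r theta : R) (f : R -> R -> R)
    (eta : R -> R -> loop) : Prop :=
  exists2 d, Killing_field r theta f d eta &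
             forall s t, in_Lambda_u d (eta s t).

Section Tau.
Variables (r theta : R) (f h : R -> R -> R) (g : R -> R -> C).

Definition tau2 (s t : R) : gl3 :=
  let p := (r / Num.sqrt (f s t))%:C in
  ('i * expi (2 * theta / 3)) *: mx3 0 p 0
                                     0 0 (f s t)%:C
                                     p 0 0.

Definition tau1 (s t : R) : gl3 :=
  ('i * expi (theta / 3)) *: mx3 0 0 (g s t)
                                 (- g s t) 0 0
                                 0 0 0.

Definition tau0 (s t : R) : gl3 :=
  'i *: mx3 (2 * h s t)%:C 0 0
            0 (- h s t)%:C 0
            0 0 (- h s t)%:C.

Definition taum1 (s t : R) : gl3 :=
  ('i * expi (- theta / 3)) *: mx3 0 (- (g s t)^*) 0
                                   0 0 0
                                   ((g s t)^*) 0 0.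

Definition taum2 (s t : R) : gl3 :=
  let p := (r / Num.sqrt (f s t))%:C in
  ('i * expi (- 2 * theta / 3)) *: mx3 0 0 p
                                       p 0 0
                                       0 (f s t)%:C 0.

Definition tau (s t : R) : loop := fun lambda =>
  lambda ^+ 2 *: tau2 s t + lambda *: tau1 s t + tau0 s t +
  lambda ^- 1 *: taum1 s t + lambda ^- 2 *: taum2 s t.

End Tau.
End Loops.

(* Main.v *)
Require Import Defs.
From HB Require Import structures.
From mathcomp Require Import all_boot all_order all_algebra.
From mathcomp Require Import complex.
From mathcomp Require Import all_classical all_reals all_analysis.
From mathcomp Require Import ring lra.
Set Implicit Arguments.
Unset Strict Implicit.
Unset Printing Implicit Defensive.
Import Order.TTheory GRing.Theory Num.Theory.
Import numFieldNormedType.Exports.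
Local Open Scope classical_set_scope.
Local Open Scope ring_scope.
Local Open Scope complex_scope.

(** Write [V = b v], [W = c w], [P = V' / 2] and [S = W' / 2].

    The two systems of ordinary differential equations reduce to one scalar
    equation each. From [|y_j|^2 = beta_j v + 1] one gets
    [v' = 2 Re (y_1 y_2 y_3)], and differentiating the product, using
    [sum_j beta_j = 0] and [sum_(j < k) beta_j beta_k = - 1 / 2], gives
    [P' = - V - 6 V^2], while [|y_1 y_2 y_3|^2] gives the energy
    [P^2 = b^2 (1 - B^2) - V^2 / 2 - 2 V^3] ([evolution_profile]); likewise for
    [W] and [S]. No division by [v'] occurs, so constant solutions need no
    separate treatment. In these terms [f = 1 / 6 + V + W], [h = V - W] and
    [g = (i S - P) / sqrt f].

    Since [b^2 + c^2 = 1 / 216] and [r^2 = b^2 B^2 + c^2 C^2], adding the two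
    energies yields a multiple of [f]:
    [P^2 + S^2 + r^2 = f (1/36 - (V + W)/6 - 2 V^2 - 2 W^2 + 2 V W)].
    The bounds [beta_j v >= -1] force [V, W >= -1/6], and on the triangle
    [V, W >= -1/6, f <= 0] the second factor is nonnegative; as the left-hand
    side is positive, [f > 0] everywhere ([profile_pos]).

    Both [tau] and the connection form depend on [lambda] and [theta] only
    through [mu = lambda e^(i theta / 3)], so the Killing equation is an
    identity between explicit matrices that are polynomial in
    [mu, mu^-1, P, S, h, sqrt f] and [1 / sqrt f]. The sum of energies turns
    the second derivatives into [P' = N - 3 f h] and [S' = N + 3 f h] with
    [N = (r^2 + P^2 + S^2) / f - f^2], after which the identity holds
    entrywise by field arithmetic ([tau_mx_killing]).

    Reality and the twisting condition are read off the matrix of [tau], as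
    complex conjugation exchanges [mu] and [mu^-1] on the unit circle.
    Smoothness holds because the coefficients lie in the algebra generated by
    [V, P, W, S] and [1 / sqrt f], which is stable under both partial
    derivatives and consists of continuous functions. *)

(** * Derivatives of real functions *)

Section RealDerivatives.
Variable R : realType.
Implicit Types (f g : R -> R) (x a b : R).

Lemma deriv_cst (c x : R) : is_derive x 1 (fun=> c) 0.
Proof. exact: is_derive_cst. Qed.

Lemma derivD f g x a b : is_derive x 1 f a -> is_derive x 1 g b ->
  is_derive x 1 (fun u => f u + g u) (a + b).
Proof. exact: is_deriveD. Qed.

Lemma derivB f g x a b : is_derive x 1 f a -> is_derive x 1 g b ->
  is_derive x 1 (fun u => f u - g u) (a - b).
Proof. exact: is_deriveB. Qed.

Lemma derivM f g x a b : is_derive x 1 f a -> is_derive x 1 g b ->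
  is_derive x 1 (fun u => f u * g u) (a * g x + f x * b).
Proof.
move=> fa gb; have := is_deriveM fa gb.
by rewrite /GRing.scale /= addrC [g x * a]mulrC.
Qed.

Lemma derivZ f x a (c : R) : is_derive x 1 f a ->
  is_derive x 1 (fun u => c * f u) (c * a).
Proof.
by move=> fa; have := derivM (deriv_cst c x) fa; rewrite mul0r add0r.
Qed.

Lemma deriv_continuous f (f' : R -> R) :
  (forall x, is_derive x 1 f (f' x)) -> continuous f.
Proof.
move=> df x; apply: differentiable_continuous.
by apply/derivable1_diffP; apply: (@ex_derive _ _ _ _ _ _ _ (df x)).
Qed.

End RealDerivatives.

(** * Reduction to scalar equations and positivity of f *)

Section Profiles.
Variable R : realType.
Implicit Types (k : 'I_3 -> R) (v : R -> R) (th : R).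

(** [V] solves [V'' = - 2 V - 12 V^2] and [P] is half its derivative; the last
    two clauses fix the energy level and keep [V] above the local maximum
    [-1/6] of the cubic [X^2 / 2 + 2 X^3]. *)
Definition profile (b B : R) (V P : R -> R) : Prop := forall s : R,
  [/\ is_derive s 1 V (2 * P s),
      is_derive s 1 P (- V s - 6 * V s ^+ 2),
      P s ^+ 2 = b ^+ 2 * (1 - B ^+ 2) - V s ^+ 2 / 2 - 2 * V s ^+ 3 &
      - 6^-1 <= V s].

Lemma sum3 k : \sum_j k j = k 0 + k 1 + k 2.
Proof.
rewrite !big_ord_recl big_ord0 addr0 addrA.
by congr (k _ + k _ + k _); apply/val_inj.
Qed.

Lemma prod3 (K : comNzRingType) (u : 'I_3 -> K) : \prod_j u j = u 0 * u 1 * u 2.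
Proof.
rewrite !big_ord_recl big_ord0 mulr1 mulrA.
by congr (u _ * u _ * u _); apply/val_inj.
Qed.

(** The only two relations between the coefficients of the system that the
    reduction uses; both [beta] and [gamma] satisfy them. *)
Definition balanced k : Prop :=
  \sum_j k j = 0 /\ k 0 * k 1 + k 1 * k 2 + k 2 * k 0 = - 2^-1.

Lemma sqrtV2 (n : nat) : (0 < n)%N -> (Num.sqrt n%:R)^-1 ^+ 2 = n%:R^-1 :> R.
Proof. by move=> n0; rewrite exprVn sqr_sqrtr. Qed.

Lemma sqr_sin (th : R) : sin th ^+ 2 = 1 - cos th ^+ 2.
Proof. by rewrite -(cos2Dsin2 th); ring. Qed.

Lemma balanced_beta th : balanced (beta th).
Proof.
have s2 : (Num.sqrt 2)^-1 ^+ 2 = 2^-1 :> R by exact: sqrtV2.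
have s6 : (Num.sqrt 6)^-1 ^+ 2 = 6^-1 :> R by exact: sqrtV2.
split; first by rewrite sum3 /beta !(tnth_nth 0) /=; ring.
rewrite /beta !(tnth_nth 0) /=.
move: s2 s6 (sqr_sin th).
move: (Num.sqrt 2)^-1 (Num.sqrt 6)^-1 (cos th) (sin th).
move=> p q c s p2 q2 cs.
transitivity (- 3 * q ^+ 2 * s ^+ 2 - p ^+ 2 * c ^+ 2); first by ring.
by rewrite p2 q2 cs; field.
Qed.

Lemma balanced_gamma th : balanced (gamma th).
Proof.
have s2 : (Num.sqrt 2)^-1 ^+ 2 = 2^-1 :> R by exact: sqrtV2.
have s6 : (Num.sqrt 6)^-1 ^+ 2 = 6^-1 :> R by exact: sqrtV2.
split; first by rewrite sum3 /gamma !(tnth_nth 0) /=; ring.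
rewrite /gamma !(tnth_nth 0) /=.
move: s2 s6 (sqr_sin th).
move: (Num.sqrt 2)^-1 (Num.sqrt 6)^-1 (cos th) (sin th).
move=> p q c s p2 q2 cs.
transitivity (- 3 * q ^+ 2 * c ^+ 2 - p ^+ 2 * s ^+ 2); first by ring.
by rewrite p2 q2 cs; field.
Qed.

Lemma sqr_prod_betaDgamma th :
  (- 2^-1 * \prod_j beta th j) ^+ 2 + (- 2^-1 * \prod_j gamma th j) ^+ 2 =
  216^-1.
Proof.
have s2 : (Num.sqrt 2)^-1 ^+ 2 = 2^-1 :> R by exact: sqrtV2.
have s6 : (Num.sqrt 6)^-1 ^+ 2 = 6^-1 :> R by exact: sqrtV2.
rewrite !prod3 /beta /gamma !(tnth_nth 0) /=.
move: s2 s6 (sqr_sin th).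
move: (Num.sqrt 2)^-1 (Num.sqrt 6)^-1 (cos th) (sin th).
move=> p q c s p2 q2 cs.
transitivity (q ^+ 2 * (s ^+ 2 * (q ^+ 2 * s ^+ 2 - p ^+ 2 * c ^+ 2) ^+ 2 +
                        c ^+ 2 * (q ^+ 2 * c ^+ 2 - p ^+ 2 * s ^+ 2) ^+ 2)).
  by field.
by rewrite p2 q2 cs; field.
Qed.

Lemma prod3_le_same_sign (x1 x2 x3 : R) : x1 + x2 + x3 = 0 ->
  -1 <= x1 -> -1 <= x2 -> 0 <= x1 * x2 ->
  3 * (x1 * x2 * x3) <= x1 ^+ 2 + x2 ^+ 2 + x3 ^+ 2.
Proof.
move=> /eqP; rewrite addrC addr_eq0 => /eqP -> h1 h2 h12.
have : 0 <= x1 * x2 * (2 + (x1 + x2)) by apply: mulr_ge0 => //; lra.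
by have := sqr_ge0 (x1 - x2); nra.
Qed.

(** Of three reals, two have a nonnegative product, which reduces the claim to
    the previous lemma. *)
Lemma prod3_le (x1 x2 x3 : R) : x1 + x2 + x3 = 0 ->
  -1 <= x1 -> -1 <= x2 -> -1 <= x3 ->
  3 * (x1 * x2 * x3) <= x1 ^+ 2 + x2 ^+ 2 + x3 ^+ 2.
Proof.
move=> x0 h1 h2 h3.
have [h12|h12] := leP 0 (x1 * x2); first exact: prod3_le_same_sign.
have [h13|h13] := leP 0 (x1 * x3).
  by have := @prod3_le_same_sign x1 x3 x2; lra.
have [h23|h23] := leP 0 (x2 * x3).
  by have := @prod3_le_same_sign x2 x3 x1; lra.
have : 0 < (x1 * x2) * (x1 * x3) by rewrite nmulr_rgt0.
have := sqr_ge0 x1; nra.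
Qed.

Lemma evolution_Re_Im k y v (j : 'I_3) (s : R)
    (a := fun j s => complex.Re (y j s))
    (b := fun j s => complex.Im (y j s)) : evolution k y v ->
  [/\ is_derive s 1 (a j)
        (k j * (a (j + 1) s * a (j + 2) s - b (j + 1) s * b (j + 2) s)),
      is_derive s 1 (b j)
        (- (k j * (a (j + 1) s * b (j + 2) s + b (j + 1) s * a (j + 2) s))) &
      a j s ^+ 2 + b j s ^+ 2 = k j * v s + 1].
Proof.
move=> /(_ j s)[[da db] n]; split; last first.
- by apply: complexI; rewrite add_Re2_Im2.
- apply: is_derive_eq db _; rewrite /a /b.
  by case: (y (j + 1) s) (y (j + 2) s) => [p q] [p' q'] /=; ring.
- apply: is_derive_eq da _; rewrite /a /b.
  by case: (y (j + 1) s) (y (j + 2) s) => [p q] [p' q'] /=; ring.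
Qed.

Lemma ReM3 (x y z : R[i]) : complex.Re (x * y * z) =
  complex.Re x * complex.Re y * complex.Re z -
  complex.Re x * complex.Im y * complex.Im z -
  complex.Im x * complex.Re y * complex.Im z -
  complex.Im x * complex.Im y * complex.Re z.
Proof. by case: x y z => [x x'] [y y'] [z z'] /=; ring. Qed.

Lemma ImM3 (x y z : R[i]) : complex.Im (x * y * z) =
  complex.Re x * complex.Re y * complex.Im z +
  complex.Re x * complex.Im y * complex.Re z +
  complex.Im x * complex.Re y * complex.Re z -
  complex.Im x * complex.Im y * complex.Im z.
Proof. by case: x y z => [x x'] [y y'] [z z'] /=; ring. Qed.

(** The lower bound in [profile] is the inequality [prod3_le] for the numbers
    [k j * v s], whose sum of squares is [(v s)^2]. *)
Lemma evolution_profile k y v B (b := - 2^-1 * \prod_j k j) :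
  balanced k -> evolution k y v ->
  (forall s, complex.Im (\prod_j y j s) = B) ->
  [/\ forall s : R, is_derive s 1 v (2 * complex.Re (\prod_j y j s)),
      forall s : R, is_derive s 1 (fun s => complex.Re (\prod_j y j s))
        (- v s - 6 * b * v s ^+ 2) &
      profile b B (fun s => b * v s) (fun s => b * complex.Re (\prod_j y j s))].
Proof.
rewrite /balanced sum3 => -[k_sum k_pair] yv imB.
pose p (s : R) := complex.Re (\prod_j y j s).
have i10 : (1 + 2 : 'I_3) = 0 by apply/val_inj.
have i20 : (2 + 1 : 'I_3) = 0 by apply/val_inj.
have i21 : (2 + 2 : 'I_3) = 1 by apply/val_inj.
have ev0 s := evolution_Re_Im 0 s yv; rewrite !add0r in ev0.
have ev1 s := evolution_Re_Im 1 s yv; rewrite i10 in ev1.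
have ev2 s := evolution_Re_Im 2 s yv; rewrite i20 i21 in ev2.
have i11 : (1 + 1 : 'I_3) = 2 by apply/val_inj.
rewrite i11 in ev1.
have dv (s : R) : is_derive s 1 v (2 * p s).
  (* v is differentiable because some k j is nonzero: it is then an affine
     function of the squared modulus of y j. *)
  have dn (j : 'I_3) (kj : k j != 0) : is_derive s 1 v ((k j)^-1 *
      (2 * complex.Re (y j s) * (k j *
        (complex.Re (y (j + 1) s) * complex.Re (y (j + 2) s) -
         complex.Im (y (j + 1) s) * complex.Im (y (j + 2) s))) +
       2 * complex.Im (y j s) * - (k j *
        (complex.Re (y (j + 1) s) * complex.Im (y (j + 2) s) +
         complex.Im (y (j + 1) s) * complex.Re (y (j + 2) s))))).
    have -> : v = fun u => (k j)^-1 *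
        (complex.Re (y j u) * complex.Re (y j u) +
         complex.Im (y j u) * complex.Im (y j u) - 1).
      apply/funext => u; have [_ _] := evolution_Re_Im j u yv.
      by rewrite -!expr2 => ->; field.
    have [da db _] := evolution_Re_Im j s yv.
    apply: is_derive_eq (derivZ _ (derivB (derivD (derivM da da)
      (derivM db db)) (deriv_cst 1 s))) _.
    by ring.
  have [k0|k0] := eqVneq (k 0) 0.
    have [k1|k1] := eqVneq (k 1) 0.
      move: k_pair; rewrite k0 k1 !mul0r !mulr0 !addr0 => /eqP.
      by rewrite eq_sym oppr_eq0 invr_eq0 pnatr_eq0.
    by apply: is_derive_eq (dn _ k1) _; rewrite i11 i10 /p prod3 ReM3; field.
  by apply: is_derive_eq (dn _ k0) _; rewrite !add0r /p prod3 ReM3; field.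
have dp (s : R) : is_derive s 1 p (- v s - 6 * b * v s ^+ 2).
  have [a0 b0 n0] := ev0 s; have [a1 b1 n1] := ev1 s; have [a2 b2 n2] := ev2 s.
  have pE : p = fun u =>
      complex.Re (y 0 u) * complex.Re (y 1 u) * complex.Re (y 2 u) -
      complex.Re (y 0 u) * complex.Im (y 1 u) * complex.Im (y 2 u) -
      complex.Im (y 0 u) * complex.Re (y 1 u) * complex.Im (y 2 u) -
      complex.Im (y 0 u) * complex.Im (y 1 u) * complex.Re (y 2 u).
    by apply/funext => u; rewrite /p prod3 ReM3.
  rewrite pE.
  apply: is_derive_eq (derivB (derivB (derivB (derivM (derivM a0 a1) a2)
    (derivM (derivM a0 b1) b2)) (derivM (derivM b0 a1) b2))
    (derivM (derivM b0 b1) a2)) _.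
  transitivity
    (k 0 * (complex.Re (y 1 s) ^+ 2 + complex.Im (y 1 s) ^+ 2) *
           (complex.Re (y 2 s) ^+ 2 + complex.Im (y 2 s) ^+ 2) +
     k 1 * (complex.Re (y 2 s) ^+ 2 + complex.Im (y 2 s) ^+ 2) *
           (complex.Re (y 0 s) ^+ 2 + complex.Im (y 0 s) ^+ 2) +
     k 2 * (complex.Re (y 0 s) ^+ 2 + complex.Im (y 0 s) ^+ 2) *
           (complex.Re (y 1 s) ^+ 2 + complex.Im (y 1 s) ^+ 2)); first by ring.
  rewrite n0 n1 n2.
  transitivity (3 * (k 0 * k 1 * k 2) * v s ^+ 2 +
    2 * (k 0 * k 1 + k 1 * k 2 + k 2 * k 0) * v s + (k 0 + k 1 + k 2)).
    by ring.
  by rewrite k_pair k_sum /b prod3; field.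
split=> // s.
have [_ _ n0] := ev0 s; have [_ _ n1] := ev1 s; have [_ _ n2] := ev2 s.
have prodk : (k 0 * v s + 1) * (k 1 * v s + 1) * (k 2 * v s + 1) =
    1 - v s ^+ 2 / 2 - 2 * b * v s ^+ 3.
  rewrite /b prod3.
  transitivity (k 0 * k 1 * k 2 * v s ^+ 3 +
    (k 0 * k 1 + k 1 * k 2 + k 2 * k 0) * v s ^+ 2 +
    (k 0 + k 1 + k 2) * v s + 1); first by ring.
  by rewrite k_pair k_sum; field.
split.
- by apply: is_derive_eq (derivZ b (dv s)) _; rewrite /p; ring.
- by apply: is_derive_eq (derivZ b (dp s)) _; ring.
- have : p s ^+ 2 + B ^+ 2 = 1 - v s ^+ 2 / 2 - 2 * b * v s ^+ 3.
    by rewrite -prodk -n0 -n1 -n2 -(imB s) /p prod3 ReM3 ImM3; ring.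
  rewrite -/(p s) => e; rewrite exprMn.
  have -> : p s ^+ 2 = 1 - v s ^+ 2 / 2 - 2 * b * v s ^+ 3 - B ^+ 2.
    by rewrite -e; ring.
  by field.
- have [v0|v0] := eqVneq (v s) 0; first by rewrite v0 mulr0; lra.
  have ge1 j : -1 <= k j * v s.
    have [_ _] := evolution_Re_Im j s yv.
    have := sqr_ge0 (complex.Re (y j s)).
    by have := sqr_ge0 (complex.Im (y j s)); lra.
  have : k 0 * v s + k 1 * v s + k 2 * v s = 0 by rewrite -!mulrDl k_sum mul0r.
  move/prod3_le => /(_ (ge1 _) (ge1 _) (ge1 _)).
  have -> : 3 * (k 0 * v s * (k 1 * v s) * (k 2 * v s)) =
      v s ^+ 2 * (- 6 * (b * v s)).
    by rewrite /b prod3; field.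
  have -> : (k 0 * v s) ^+ 2 + (k 1 * v s) ^+ 2 + (k 2 * v s) ^+ 2 =
      v s ^+ 2 * 1.
    transitivity (v s ^+ 2 * ((k 0 + k 1 + k 2) ^+ 2 -
      2 * (k 0 * k 1 + k 1 * k 2 + k 2 * k 0))); first by ring.
    by rewrite k_sum k_pair; congr (_ * _); field.
  by rewrite ler_pM2l ?exprn_even_gt0//; lra.
Qed.

(** Where [V] and [W] are at least [-1/6] and [f <= 0], the cofactor of [f] in
    the sum of energies is nonnegative; so that sum, which is positive, would
    be nonpositive. *)
Lemma profile_pos b c B C r V P W S : profile b B V P -> profile c C W S ->
  b ^+ 2 + c ^+ 2 = 216^-1 -> r ^+ 2 = (b * B) ^+ 2 + (c * C) ^+ 2 -> r != 0 ->
  forall s t, 0 < 6^-1 + V s + W t.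
Proof.
move=> VP WS bc r2 r0 s t.
have [_ _ eV hV] := VP s; have [_ _ eW hW] := WS t.
move: (V s) (P s) (W t) (S t) eV hV eW hW => X p Y q eV hV eW hW.
have {}r0 : 0 < r ^+ 2 by rewrite exprn_even_gt0.
have key : (6^-1 + X + Y) *
    (36^-1 - (X + Y) / 6 - 2 * X ^+ 2 - 2 * Y ^+ 2 + 2 * X * Y) =
    p ^+ 2 + q ^+ 2 + r ^+ 2 by rewrite eV eW r2; nra.
rewrite ltNge; apply/negP => f0.
have : 0 <= 36^-1 - (X + Y) / 6 - 2 * X ^+ 2 - 2 * Y ^+ 2 + 2 * X * Y.
  by nra.
move=> Q0; have := mulr_le0_ge0 f0 Q0; rewrite key.
by have := sqr_ge0 p; have := sqr_ge0 q; lra.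
Qed.
End Profiles.

(** * Smoothness *)

Section Smoothness.
Variable R : realType.
Implicit Types u w : R -> R -> R.

(** A class of continuous functions stable under both partial derivatives
    consists of smooth functions. *)
Lemma smooth_closed (A : (R -> R -> R) -> Prop) :
  (forall u, A u -> continuous (fun p : R * R => u p.1 p.2)) ->
  (forall u, A u -> exists2 u', A u' &
     forall s t : R, is_derive s 1 (fun s' => u s' t) (u' s t)) ->
  (forall u, A u -> exists2 u', A u' &
     forall s t : R, is_derive t 1 (fun t' => u s t') (u' s t)) ->
  forall u, A u -> smooth u.
Proof.
move=> Ac As At u Au n; elim: n u Au => [|n IHn] u Au.
  by split=> //; apply: Ac.
split; first exact: Ac.
have [us Aus dus] := As _ Au; have [ut Aut dut] := At _ Au.
split=> [s t|s t||].
- exact: (@ex_derive _ _ _ _ _ _ _ (dus s t)).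
- exact: (@ex_derive _ _ _ _ _ _ _ (dut s t)).
- suff -> : partial_s u = us by apply: IHn.
  apply/funext => s; apply/funext => t.
  by rewrite /partial_s derive1E (@derive_val _ _ _ _ _ _ _ (dus s t)).
- suff -> : partial_t u = ut by apply: IHn.
  apply/funext => s; apply/funext => t.
  by rewrite /partial_t derive1E (@derive_val _ _ _ _ _ _ _ (dut s t)).
Qed.

Lemma deriv_invsqrt (f : R -> R) (f' x : R) : 0 < f x -> is_derive x 1 f f' ->
  is_derive x 1 (fun a => (Num.sqrt (f a))^-1)
    (- 2^-1 * f' * (Num.sqrt (f x))^-1 ^+ 3).
Proof.
move=> f0 df; have s0 : Num.sqrt (f x) != 0 by rewrite sqrtr_eq0 -ltNge.
have ds := is_derive1_comp (is_derive1_sqrt f0) df.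
have dsV := @is_deriveV R (fun a => Num.sqrt (f a)) _ _ _ s0 ds.
apply: is_derive_eq dsV _.
by rewrite /GRing.scale /=; field.
Qed.

Section GeneratedAlgebra.
Variables (b B c C : R) (V P W S : R -> R).
Hypothesis VP : profile b B V P.
Hypothesis WS : profile c C W S.
Let f s t := 6^-1 + V s + W t.
Hypothesis f_gt0 : forall s t, 0 < f s t.

(** The real algebra of functions of [(s, t)] generated by [V], [P], [W], [S]
    and [1 / sqrt f]. It contains [f] itself, but [sqrt f] is not needed. *)
Inductive in_alg : (R -> R -> R) -> Prop :=
| in_alg_cst a : in_alg (fun _ _ => a)
| in_alg_V : in_alg (fun s _ => V s)
| in_alg_P : in_alg (fun s _ => P s)
| in_alg_W : in_alg (fun _ t => W t)
| in_alg_S : in_alg (fun _ t => S t)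
| in_alg_invsqrt : in_alg (fun s t => (Num.sqrt (f s t))^-1)
| in_algD u w : in_alg u -> in_alg w -> in_alg (fun s t => u s t + w s t)
| in_algM u w : in_alg u -> in_alg w -> in_alg (fun s t => u s t * w s t).

Lemma deriv_s_f (s t : R) : is_derive s 1 (fun a => f a t) (2 * P s).
Proof.
have [dV _ _ _] := VP s.
apply: is_derive_eq
  (derivD (derivD (deriv_cst 6^-1 s) dV) (deriv_cst (W t) s)) _.
by ring.
Qed.

Lemma deriv_t_f (s t : R) : is_derive t 1 (fun a => f s a) (2 * S t).
Proof.
have [dW _ _ _] := WS t.
by apply: is_derive_eq (derivD (deriv_cst (6^-1 + V s) t) dW) _; ring.
Qed.

Lemma deriv_s_invsqrt (s t : R) : is_derive s 1
  (fun a => (Num.sqrt (f a t))^-1) (- P s * (Num.sqrt (f s t))^-1 ^+ 3).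
Proof.
apply: is_derive_eq (@deriv_invsqrt (f^~ t) _ _ (f_gt0 s t) (deriv_s_f s t)) _.
by field; rewrite sqrtr_eq0 -ltNge.
Qed.

Lemma deriv_t_invsqrt (s t : R) : is_derive t 1
  (fun a => (Num.sqrt (f s a))^-1) (- S t * (Num.sqrt (f s t))^-1 ^+ 3).
Proof.
apply: is_derive_eq (@deriv_invsqrt (f s) _ _ (f_gt0 s t) (deriv_t_f s t)) _.
by field; rewrite sqrtr_eq0 -ltNge.
Qed.

Lemma in_alg_smooth u : in_alg u -> smooth u.
Proof.
have dV (s : R) : is_derive s 1 V (2 * P s) by case: (VP s).
have dP (s : R) : is_derive s 1 P (- V s - 6 * V s ^+ 2) by case: (VP s).
have dW (s : R) : is_derive s 1 W (2 * S s) by case: (WS s).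
have dS (s : R) : is_derive s 1 S (- W s - 6 * W s ^+ 2) by case: (WS s).
have c1 F : continuous F -> continuous (fun p : R * R => F p.1).
  by move=> Fc p; apply: (cvg_comp _ _ cvg_fst); apply: Fc.
have c2 F : continuous F -> continuous (fun p : R * R => F p.2).
  by move=> Fc p; apply: (cvg_comp _ _ cvg_snd); apply: Fc.
apply: smooth_closed => {u} u.
- elim => {u} [a|||||| u w _ uc _ wc | u w _ uc _ wc].
  + by move=> p; apply: cvg_cst.
  + exact: c1 (deriv_continuous dV).
  + exact: c1 (deriv_continuous dP).
  + exact: c2 (deriv_continuous dW).
  + exact: c2 (deriv_continuous dS).
  + have fc : continuous (fun p : R * R => f p.1 p.2).
      move=> p; apply: cvgD; last exact: c2 (deriv_continuous dW) _.
      by apply: cvgD; [exact: cvg_cst|exact: c1 (deriv_continuous dV) _].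
    move=> p; apply: (@continuousV _ _ (fun p => Num.sqrt (f p.1 p.2)) p).
      by rewrite sqrtr_eq0 -ltNge.
    exact: continuous_comp (fc p) (@sqrt_continuous R _).
  + by move=> p; apply: cvgD; [apply: uc|apply: wc].
  + by move=> p; apply: cvgM; [apply: uc|apply: wc].
- elim => {u} [a|||||| u w eu [u' eu' du] ew [w' ew' dw]
                    | u w eu [u' eu' du] ew [w' ew' dw]].
  + exists (fun _ _ => 0); first exact: in_alg_cst.
    by move=> s t; apply: deriv_cst.
  + exists (fun s _ => 2 * P s) => //.
    exact: in_algM (in_alg_cst _) in_alg_P.
  + exists (fun s _ => - 1 * V s + - 6 * (V s * V s)).
      apply: in_algD (in_algM (in_alg_cst _) in_alg_V) _.
      exact: in_algM (in_alg_cst _) (in_algM in_alg_V in_alg_V).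
    by move=> s t; apply: is_derive_eq (dP s) _; ring.
  + exists (fun _ _ => 0); first exact: in_alg_cst.
    by move=> s t; apply: deriv_cst.
  + exists (fun _ _ => 0); first exact: in_alg_cst.
    by move=> s t; apply: deriv_cst.
  + pose q s t := (Num.sqrt (f s t))^-1.
    exists (fun s t => - 1 * P s * (q s t * q s t * q s t)).
      apply: in_algM (in_algM (in_alg_cst _) in_alg_P) _.
      exact: in_algM (in_algM in_alg_invsqrt in_alg_invsqrt) in_alg_invsqrt.
    move=> s t; apply: is_derive_eq (deriv_s_invsqrt s t) _.
    by rewrite /q; ring.
  + exists (fun s t => u' s t + w' s t); first exact: in_algD.
    by move=> s t; apply: derivD.
  + exists (fun s t => u' s t * w s t + u s t * w' s t).
      by apply: in_algD; apply: in_algM.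
    by move=> s t; apply: (derivM (du s t) (dw s t)).
- elim => {u} [a|||||| u w eu [u' eu' du] ew [w' ew' dw]
                    | u w eu [u' eu' du] ew [w' ew' dw]].
  + exists (fun _ _ => 0); first exact: in_alg_cst.
    by move=> s t; apply: deriv_cst.
  + exists (fun _ _ => 0); first exact: in_alg_cst.
    by move=> s t; apply: deriv_cst.
  + exists (fun _ _ => 0); first exact: in_alg_cst.
    by move=> s t; apply: deriv_cst.
  + exists (fun _ t => 2 * S t) => //.
    exact: in_algM (in_alg_cst _) in_alg_S.
  + exists (fun _ t => - 1 * W t + - 6 * (W t * W t)).
      apply: in_algD (in_algM (in_alg_cst _) in_alg_W) _.
      exact: in_algM (in_alg_cst _) (in_algM in_alg_W in_alg_W).
    by move=> s t; apply: is_derive_eq (dS t) _; ring.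
  + pose q s t := (Num.sqrt (f s t))^-1.
    exists (fun s t => - 1 * S t * (q s t * q s t * q s t)).
      apply: in_algM (in_algM (in_alg_cst _) in_alg_S) _.
      exact: in_algM (in_algM in_alg_invsqrt in_alg_invsqrt) in_alg_invsqrt.
    move=> s t; apply: is_derive_eq (deriv_t_invsqrt s t) _.
    by rewrite /q; ring.
  + exists (fun s t => u' s t + w' s t); first exact: in_algD.
    by move=> s t; apply: derivD.
  + exists (fun s t => u' s t * w s t + u s t * w' s t).
      by apply: in_algD; apply: in_algM.
    by move=> s t; apply: (derivM (du s t) (dw s t)).
Qed.

End GeneratedAlgebra.
End Smoothness.

(** * The Killing equation as a matrix identity *)

Section MatrixAlgebra.
Variable R : realType.
Local Notation K := R[i].

Section Mx3.
Variables a11 a12 a13 a21 a22 a23 a31 a32 a33 : K.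
Variables b11 b12 b13 b21 b22 b23 b31 b32 b33 : K.
Local Notation mxa := (mx3 a11 a12 a13 a21 a22 a23 a31 a32 a33).
Local Notation mxb := (mx3 b11 b12 b13 b21 b22 b23 b31 b32 b33).

Lemma mx3Z x : x *: mxa = mx3 (x * a11) (x * a12) (x * a13) (x * a21)
  (x * a22) (x * a23) (x * a31) (x * a32) (x * a33).
Proof.
by apply/matrixP => -[[|[|[|//]]] i] [[|[|[|//]]] j]; rewrite !mxE.
Qed.

Lemma mx3D : mxa + mxb = mx3 (a11 + b11) (a12 + b12) (a13 + b13) (a21 + b21)
  (a22 + b22) (a23 + b23) (a31 + b31) (a32 + b32) (a33 + b33).
Proof.
by apply/matrixP => -[[|[|[|//]]] i] [[|[|[|//]]] j]; rewrite !mxE.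
Qed.

Lemma mx3N : - mxa = mx3 (- a11) (- a12) (- a13) (- a21) (- a22) (- a23)
  (- a31) (- a32) (- a33).
Proof.
by apply/matrixP => -[[|[|[|//]]] i] [[|[|[|//]]] j]; rewrite !mxE.
Qed.

Lemma mx3M : mxa *m mxb =
  mx3 (a11 * b11 + a12 * b21 + a13 * b31) (a11 * b12 + a12 * b22 + a13 * b32)
      (a11 * b13 + a12 * b23 + a13 * b33)
      (a21 * b11 + a22 * b21 + a23 * b31) (a21 * b12 + a22 * b22 + a23 * b32)
      (a21 * b13 + a22 * b23 + a23 * b33)
      (a31 * b11 + a32 * b21 + a33 * b31) (a31 * b12 + a32 * b22 + a33 * b32)
      (a31 * b13 + a32 * b23 + a33 * b33).
Proof.
by apply/matrixP => -[[|[|[|//]]] i] [[|[|[|//]]] j];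
  rewrite !mxE !big_ord_recl big_ord0 !mxE addr0 addrA.
Qed.

Lemma mx3_map_tr (c : K -> K) : (map_mx c mxa)^T =
  mx3 (c a11) (c a21) (c a31) (c a12) (c a22) (c a32) (c a13) (c a23) (c a33).
Proof.
by apply/matrixP => -[[|[|[|//]]] i] [[|[|[|//]]] j]; rewrite !mxE.
Qed.

End Mx3.

Lemma mx3_one : 1%:M = mx3 1 0 0 0 1 0 0 0 1 :> 'M[K]_3.
Proof.
by apply/matrixP => -[[|[|[|//]]] i] [[|[|[|//]]] j]; rewrite !mxE.
Qed.

(** The matrix of [tau] as a linear function of the five real quantities
    [1 / sqrt f], [P / sqrt f], [S / sqrt f], [f] and [h]. Here [m] stands for
    [mu = lambda e^(i theta / 3)] and [n] for its inverse; they are kept as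
    independent arguments because conjugation and twisting act on both. *)
Definition tau_mx (r m n u1 u2 u3 u4 u5 : K) : 'M[K]_3 :=
  let p := n * 'i * (u2 + 'i * u3) in
  let q := m * 'i * ('i * u3 - u2) in
  let x := m ^+ 2 * 'i * r * u1 in
  let y := n ^+ 2 * 'i * r * u1 in
  mx3 (2 * 'i * u5) (x + p) (q + y)
      (y - q) (- 'i * u5) (m ^+ 2 * 'i * u4)
      (x - p) (n ^+ 2 * 'i * u4) (- 'i * u5).

Lemma tau_mx_lin r m n u1 u2 u3 u4 u5 : tau_mx r m n u1 u2 u3 u4 u5 =
  u1 *: tau_mx r m n 1 0 0 0 0 + u2 *: tau_mx r m n 0 1 0 0 0 +
  u3 *: tau_mx r m n 0 0 1 0 0 + u4 *: tau_mx r m n 0 0 0 1 0 +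
  u5 *: tau_mx r m n 0 0 0 0 1.
Proof. by rewrite /tau_mx !mx3Z !mx3D; congr (mx3 _ _ _ _ _ _ _ _ _); ring. Qed.

Lemma conjci : ('i%R : K)^* = - 'i%R.
Proof. by rewrite -complexiE; simpc. Qed.

Lemma map_tau_mx (c : {rmorphism K -> K}) (r m n u1 u2 u3 u4 u5 : K) :
  c 'i%R = - 'i%R -> c m = n -> c n = m -> c r = r ->
  c u1 = u1 -> c u2 = u2 -> c u3 = u3 -> c u4 = u4 -> c u5 = u5 ->
  (map_mx c (tau_mx r m n u1 u2 u3 u4 u5))^T = - tau_mx r m n u1 u2 u3 u4 u5.
Proof.
move=> ci cm cn cr c1 c2 c3 c4 c5; rewrite /tau_mx mx3_map_tr mx3N.
move: ci; move: 'i%R => i ci.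
rewrite !(rmorphD, rmorphN, rmorphM, rmorphXn, rmorph_nat).
rewrite ci cm cn cr c1 c2 c3 c4 c5.
by congr (mx3 _ _ _ _ _ _ _ _ _); ring.
Qed.

Lemma tau_mx_skew (r u1 u2 u3 u4 u5 : R) (m n : K) : m^* = n -> n^* = m ->
  skew_hermitian (tau_mx r%:C m n u1%:C u2%:C u3%:C u4%:C u5%:C).
Proof.
move=> mE nE; apply: map_tau_mx; [exact: conjci|exact: mE|exact: nE|..];
  exact: conjc_real.
Qed.

(** The value of the connection form on a tangent vector [X], where
    [x = X_1 + i X_2], [xb = X_1 - i X_2] and [s] stands for [sqrt f]. *)
Definition alpha_mx (r m x xb s P S : K) : 'M[K]_3 :=
  let a := 2^-1 * (x * (P - 'i * S) - xb * (P + 'i * S)) / s ^+ 2 in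
  mx3 0 (- xb / m * s) (m * x * s)
      (m * x * s) a (- xb / m * r / s ^+ 2)
      (- xb / m * s) (m * x * r / s ^+ 2) (- a).

(** The argument of [tau_mx] on the left is the derivative, in the direction
    [(x1, x2)], of the argument of [T], [Ps] and [St] being the derivatives of
    [P] and [S], and [d] that of [1 / sqrt f]. *)
Lemma tau_mx_killing (r m s P S H x1 x2 : K) :
  m != 0 -> s != 0 ->
  let N := (r ^+ 2 + P ^+ 2 + S ^+ 2) / s ^+ 2 - s ^+ 4 in
  let Ps := N - 3 * s ^+ 2 * H in
  let St := N + 3 * s ^+ 2 * H in
  let T := tau_mx r m m^-1 s^-1 (P * s^-1) (S * s^-1) (s ^+ 2) H in
  let A := alpha_mx r m (x1 + 'i * x2) (x1 - 'i * x2) s P S in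
  let d := - (x1 * P + x2 * S) / s ^+ 3 in
  tau_mx r m m^-1 d (x1 * Ps / s + P * d) (x2 * St / s + S * d)
    (2 * (x1 * P + x2 * S)) (2 * (x1 * P - x2 * S)) =
  T *m A - A *m T.
Proof.
move=> m0 s0 N Ps St T A d.
have i2 : 'i%R ^+ 2 = - 1 :> K by rewrite -complexiE sqr_i.
rewrite /T /A /d /St /Ps /N /tau_mx /alpha_mx !mx3M mx3N mx3D.
move: i2; move: 'i%R => I i2.
congr (mx3 _ _ _ _ _ _ _ _ _); field: i2; rewrite m0 s0//.
Qed.

Lemma tau_mxD2 (r m n u1 u2 u3 u4 u5 v1 v2 v3 v4 v5 x y : K) :
  x *: tau_mx r m n u1 u2 u3 u4 u5 + y *: tau_mx r m n v1 v2 v3 v4 v5 =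
  tau_mx r m n (x * u1 + y * v1) (x * u2 + y * v2) (x * u3 + y * v3)
     (x * u4 + y * v4) (x * u5 + y * v5).
Proof. by rewrite /tau_mx !mx3Z !mx3D; congr (mx3 _ _ _ _ _ _ _ _ _); ring. Qed.

(** [tau_mx_killing] with the two partial derivatives kept apart, for real
    quantities seen in [R[i]]. *)
Lemma tau_mx_killing_real (r s P S H x1 x2 : R) (m : K) :
  m != 0 -> s != 0 ->
  let N := (r ^+ 2 + P ^+ 2 + S ^+ 2) / s ^+ 2 - (s ^+ 2) ^+ 2 in
  let Ps := N - 3 * s ^+ 2 * H in
  let St := N + 3 * s ^+ 2 * H in
  let T := tau_mx r%:C m m^-1 s^-1%:C (P * s^-1)%:C (S * s^-1)%:C
    (s ^+ 2)%:C H%:C in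
  let A := alpha_mx r%:C m (x1%:C + 'i%R * x2%:C) (x1%:C - 'i%R * x2%:C)
    s%:C P%:C S%:C in
  x1%:C *: tau_mx r%:C m m^-1 (- P / s ^+ 3)%:C
    (Ps / s - P * (P / s ^+ 3))%:C (- (S * (P / s ^+ 3)))%:C
    (2 * P)%:C (2 * P)%:C +
  x2%:C *: tau_mx r%:C m m^-1 (- S / s ^+ 3)%:C
    (- (P * (S / s ^+ 3)))%:C (St / s - S * (S / s ^+ 3))%:C
    (2 * S)%:C (- (2 * S))%:C =
  T *m A - A *m T.
Proof.
move=> m0 s0 N Ps St T A; rewrite /T /A /St /Ps /N {T A St Ps N} tau_mxD2.
have sC0 : s%:C != 0 :> K by rewrite fmorph_eq0.
have V3 (a b : R) : (a / b)%:C = a%:C / b%:C :> K.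
  by rewrite rmorphM; congr (_ * _); exact: fmorphV.
have M3 (a b : R) : (a * b)%:C = a%:C * b%:C :> K by exact: rmorphM.
have D3 (a b : R) : (a + b)%:C = a%:C + b%:C :> K by exact: rmorphD.
have N3 (a : R) : (- a)%:C = - a%:C :> K by exact: rmorphN.
have X3 (a : R) n : (a ^+ n)%:C = a%:C ^+ n :> K by exact: rmorphXn.
have n3 n : (n%:R)%:C = n%:R :> K by exact: rmorph_nat.
have E1 : s^-1%:C = s%:C^-1 :> K by exact: fmorphV.
rewrite E1 (V3 P s) (V3 S s) (X3 s 2%N).
rewrite -(tau_mx_killing r%:C P%:C S%:C H%:C x1%:C x2%:C m0 sC0).
by congr tau_mx; rewrite ?(V3, M3, D3, N3, X3, n3); field.
Qed.

Lemma expiD (x y : R) : expi (x + y) = expi x * expi y.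
Proof. by rewrite /expi cosD sinD; simpc; congr (_ +i* _); ring. Qed.

Lemma expi0 : expi 0 = 1 :> K.
Proof. by rewrite /expi cos0 sin0. Qed.

Lemma expi_neq0 (x : R) : expi x != 0.
Proof.
have h : expi x * expi (- x) = 1 by rewrite -expiD subrr expi0.
by apply/eqP => e0; move: h => /eqP; rewrite e0 mul0r eq_sym oner_eq0.
Qed.

Lemma expiN (x : R) : expi (- x) = (expi x)^-1.
Proof.
by apply: (mulfI (expi_neq0 x)); rewrite -expiD subrr expi0 divff ?expi_neq0.
Qed.

Lemma conjc_expi (x : R) : (expi x)^* = (expi x)^-1.
Proof. by rewrite -expiN /expi cosN sinN. Qed.

Lemma zeta3 : zeta R ^+ 3 = 1.
Proof.
rewrite /zeta !exprS expr0 mulr1 -!expiD.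
have -> : 2 * pi / 3 + (2 * pi / 3 + 2 * pi / 3) = pi + pi :> R by field.
rewrite expiD -expr2 /expi cospi sinpi complexr0 rmorphN rmorph1.
by rewrite sqrrN expr1n.
Qed.

Lemma UpsilonE : Upsilon R = mx3 1 0 0 0 (zeta R) 0 0 0 (zeta R ^+ 2).
Proof.
by apply/matrixP => -[[|[|[|//]]] i] [[|[|[|//]]] j]; rewrite !mxE.
Qed.

Lemma tau_mx_twist r m n u1 u2 u3 u4 u5 :
  tau_mx r (zeta R * m) ((zeta R)^-1 * n) u1 u2 u3 u4 u5 =
  Upsilon R *m tau_mx r m n u1 u2 u3 u4 u5 *m invmx (Upsilon R).
Proof.
have z3 := zeta3; have z0 : zeta R != 0 := expi_neq0 _.
have -> : (zeta R)^-1 = zeta R ^+ 2.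
  by apply: (mulfI z0); rewrite divff// -exprS.
have U : Upsilon R \in unitmx.
  suff /mulmx1_unit [] :
    Upsilon R *m mx3 1 0 0 0 (zeta R ^+ 2) 0 0 0 (zeta R) = 1%:M by [].
  rewrite UpsilonE mx3M mx3_one; move: (zeta R) z3 => z z3.
  by congr (mx3 _ _ _ _ _ _ _ _ _); ring: z3.
(* The equality with the inverse cleared is polynomial, modulo zeta^3 = 1. *)
apply: (canRL (mulmxK U)); rewrite UpsilonE /tau_mx !mx3M.
move: (zeta R) z3 => z z3.
by congr (mx3 _ _ _ _ _ _ _ _ _); ring: z3.
Qed.

End MatrixAlgebra.

(** * The Killing equation for tau *)

Section KillingEquation.
Variable R : realType.
Local Notation K := R[i].

Lemma mxderive1_tau_mx (r m n : K) (u1 u2 u3 u4 u5 : R -> R)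
    (x d1 d2 d3 d4 d5 : R) :
  is_derive x 1 u1 d1 -> is_derive x 1 u2 d2 -> is_derive x 1 u3 d3 ->
  is_derive x 1 u4 d4 -> is_derive x 1 u5 d5 ->
  mxderive1 (fun a => tau_mx r m n (u1 a)%:C (u2 a)%:C (u3 a)%:C (u4 a)%:C
    (u5 a)%:C) x = tau_mx r m n d1%:C d2%:C d3%:C d4%:C d5%:C.
Proof.
move=> h1 h2 h3 h4 h5; apply/matrixP => i j; rewrite mxE.
rewrite /cderive1.
pose c1 := tau_mx r m n 1 0 0 0 0 i j; pose c2 := tau_mx r m n 0 1 0 0 0 i j.
pose c3 := tau_mx r m n 0 0 1 0 0 i j; pose c4 := tau_mx r m n 0 0 0 1 0 i j.
pose c5 := tau_mx r m n 0 0 0 0 1 i j.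
have DE (A B : 'M[K]_3) : (A + B) i j = A i j + B i j by rewrite mxE.
have ZE z (A : 'M[K]_3) : (z *: A) i j = z * A i j by rewrite mxE.
have E (a1 a2 a3 a4 a5 : R) :
  tau_mx r m n a1%:C a2%:C a3%:C a4%:C a5%:C i j =
  (complex.Re c1 * a1 + complex.Re c2 * a2 + complex.Re c3 * a3 +
   complex.Re c4 * a4 + complex.Re c5 * a5) +i*
  (complex.Im c1 * a1 + complex.Im c2 * a2 + complex.Im c3 * a3 +
   complex.Im c4 * a4 + complex.Im c5 * a5).
  rewrite tau_mx_lin !DE !ZE -/c1 -/c2 -/c3 -/c4 -/c5.
  case: c1 c2 c3 c4 c5 => [? ?] [? ?] [? ?] [? ?] [? ?].
  by apply/eqP; rewrite eq_complex /=; apply/andP; split; apply/eqP; ring.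
rewrite E; congr (_ +i* _); rewrite derive1E; under eq_fun do rewrite E /=.
- by apply: (@derive_val _ _ _ _ _ _ _ (derivD (derivD (derivD (derivD
    (derivZ _ h1) (derivZ _ h2)) (derivZ _ h3)) (derivZ _ h4)) (derivZ _ h5))).
- by apply: (@derive_val _ _ _ _ _ _ _ (derivD (derivD (derivD (derivD
    (derivZ _ h1) (derivZ _ h2)) (derivZ _ h3)) (derivZ _ h4)) (derivZ _ h5))).
Qed.

Variables (r theta : R) (f h : R -> R -> R) (g : R -> R -> K).
Variables (P S : R -> R).
Hypothesis r_gt0 : 0 < r.
Hypothesis f_gt0 : forall s t, 0 < f s t.
Hypothesis fs : forall s t : R, is_derive s 1 (fun a => f a t) (2 * P s).
Hypothesis ft : forall s t : R, is_derive t 1 (fun a => f s a) (2 * S t).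
Hypothesis gE : forall s t,
  g s t = (Num.sqrt (f s t))^-1%:C * ('i%R * (S t)%:C - (P s)%:C).

Let sqrtf_neq0 s t : Num.sqrt (f s t) != 0.
Proof. by rewrite sqrtr_eq0 -ltNge. Qed.

Let fE s t : f s t = Num.sqrt (f s t) ^+ 2.
Proof. by rewrite sqr_sqrtr// ltW. Qed.

Let mu lambda := lambda * expi (theta / 3).

Lemma tauE lambda s t : lambda != 0 ->
  tau r theta f h g s t lambda = tau_mx r%:C (mu lambda) (mu lambda)^-1
    (Num.sqrt (f s t))^-1%:C (P s * (Num.sqrt (f s t))^-1)%:C
    (S t * (Num.sqrt (f s t))^-1)%:C (f s t)%:C (h s t)%:C.
Proof.
move=> l0.
have e2 : expi (2 * theta / 3) = expi (theta / 3) ^+ 2.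
  by rewrite expr2 -expiD; congr expi; field.
have e1 : expi (- theta / 3) = (expi (theta / 3))^-1.
  by rewrite -expiN; congr expi; field.
have e3 : expi (- 2 * theta / 3) = (expi (theta / 3))^-1 ^+ 2.
  by rewrite -expiN expr2 -expiD; congr expi; field.
have gJ : (g s t)^*%C =
    (Num.sqrt (f s t))^-1%:C * (- 'i%R * (S t)%:C - (P s)%:C).
  rewrite gE -!complexiE; apply/eqP.
  by rewrite eq_complex /=; apply/andP; split; apply/eqP; ring.
(* Two convertible forms of complex conjugation occur in the matrices. *)
have gJ' : (g s t)^*%R = (g s t)^*%C by [].
rewrite /tau /tau2 /tau1 /tau0 /taum1 /taum2 gJ' !gJ !gE e1 e2 e3 !mx3Z !mx3D.
rewrite /tau_mx /mu ?complexiE.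
have /negbTE e0 := expi_neq0 (theta / 3).
rewrite !(rmorphM, rmorphN, fmorphV) /=.
have s0 : (Num.sqrt (f s t))%:C != 0 :> K by rewrite fmorph_eq0.
move: (expi _) e0 ((Num.sqrt (f s t))%:C) s0 => e /negbT e0 q q0.
rewrite rmorph_nat.
by congr (mx3 _ _ _ _ _ _ _ _ _); field; rewrite ?l0 ?e0 ?q0.
Qed.

Lemma partial_s_log s t : partial_s (log_f f) s t = 2 * P s / f s t.
Proof.
rewrite /partial_s derive1E.
rewrite (@derive_val _ _ _ _ _ _ _
  (is_derive1_comp (is_derive1_ln (f_gt0 s t)) (fs s t))).
by rewrite mulrC.
Qed.

Lemma partial_t_log s t : partial_t (log_f f) s t = 2 * S t / f s t.
Proof.
rewrite /partial_t derive1E.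
rewrite (@derive_val _ _ _ _ _ _ _
  (is_derive1_comp (is_derive1_ln (f_gt0 s t)) (ft s t))).
by rewrite mulrC.
Qed.

Lemma alphaE lambda s t X : lambda != 0 ->
  alpha r theta f lambda s t X = alpha_mx r%:C (mu lambda)
    (X.1%:C + 'i%R * X.2%:C) (X.1%:C - 'i%R * X.2%:C)
    (Num.sqrt (f s t))%:C (P s)%:C (S t)%:C.
Proof.
move=> l0.
have XE (x y : R) : x +i* y = x%:C + 'i%R * y%:C.
  by rewrite [LHS]complexE complexiE.
have eJ : (cbrt_xi r theta)^*%R = (r `^ 3^-1)%:C / expi (theta / 3).
  by rewrite rmorphM; congr (_ * _); [exact: conjc_real|exact: conjc_expi].
have eJ' : (cbrt_xi r theta)^*%C = (r `^ 3^-1)%:C / expi (theta / 3) := eJ.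
rewrite /alpha /dz /dzbar /alpha1' /alpha0' /alpham1'' /alpha0''.
rewrite /partial_z /partial_zbar.
rewrite ?eJ ?eJ' !partial_s_log !partial_t_log !XE /cbrt_xi.
rewrite !mx3Z !mx3D !mx3Z mx3D.
have sE : (f s t)%:C = (Num.sqrt (f s t))%:C ^+ 2 :> K.
  by rewrite [in LHS]fE rmorphXn.
rewrite /alpha_mx /mu.
rewrite !(rmorphM, rmorphN, fmorphV) /= !sE rmorph_nat.
have e0 := expi_neq0 (theta / 3).
have s0 : (Num.sqrt (f s t))%:C != 0 :> K by rewrite fmorph_eq0.
have r0 : (r `^ 3^-1)%:C != 0 :> K by rewrite fmorph_eq0 gt_eqF// powR_gt0.
move: (expi _) e0 ((Num.sqrt (f s t))%:C) s0 => e e0 q q0.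
move: ((r `^ 3^-1)%:C) r0 => k k0.
by congr (mx3 _ _ _ _ _ _ _ _ _); field; rewrite ?l0 ?e0 ?q0 ?k0.
Qed.

Variables Pd Sd : R -> R.
Hypothesis hs : forall s t : R, is_derive s 1 (fun a => h a t) (2 * P s).
Hypothesis ht : forall s t : R, is_derive t 1 (fun a => h s a) (- (2 * S t)).
Hypothesis dP : forall s : R, is_derive s 1 P (Pd s).
Hypothesis dS : forall t : R, is_derive t 1 S (Sd t).
Let N s t := (r ^+ 2 + P s ^+ 2 + S t ^+ 2) / f s t - f s t ^+ 2.
Hypothesis PdE : forall s t, Pd s = N s t - 3 * f s t * h s t.
Hypothesis SdE : forall s t, Sd t = N s t + 3 * f s t * h s t.

Lemma tau_killing lambda s t X : lambda != 0 ->
  let A := alpha r theta f lambda s t X in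
  ext_d (fun s' t' => tau r theta f h g s' t' lambda) s t X =
  tau r theta f h g s t lambda *m A - A *m tau r theta f h g s t lambda.
Proof.
move=> l0; cbv zeta; rewrite alphaE// tauE//.
have q0 := sqrtf_neq0 s t; have qq := fE s t.
have qs := deriv_invsqrt (f_gt0 s t) (fs s t).
have qt := deriv_invsqrt (f_gt0 s t) (ft s t).
pose q := Num.sqrt (f s t).
have Ds : mxderive1 (fun a => tau r theta f h g a t lambda) s =
  tau_mx r%:C (mu lambda) (mu lambda)^-1 (- P s / q ^+ 3)%:C
    (Pd s / q - P s * (P s / q ^+ 3))%:C (- (S t * (P s / q ^+ 3)))%:C
    (2 * P s)%:C (2 * P s)%:C.
  under eq_fun do rewrite tauE//.
  apply: (mxderive1_tau_mx _ _ _ _ _ _ (fs s t) (hs s t)).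
  - by apply: is_derive_eq qs _; rewrite -/q; field.
  - by apply: is_derive_eq (derivM (dP s) qs) _; rewrite -/q; field.
  - apply: is_derive_eq (derivM (deriv_cst (S t) s) qs) _.
    by rewrite -/q; field.
have Dt : mxderive1 (fun a => tau r theta f h g s a lambda) t =
  tau_mx r%:C (mu lambda) (mu lambda)^-1 (- S t / q ^+ 3)%:C
    (- (P s * (S t / q ^+ 3)))%:C (Sd t / q - S t * (S t / q ^+ 3))%:C
    (2 * S t)%:C (- (2 * S t))%:C.
  under eq_fun do rewrite tauE//.
  apply: (mxderive1_tau_mx _ _ _ _ _ _ (ft s t) (ht s t)).
  - by apply: is_derive_eq qt _; rewrite -/q; field.
  - apply: is_derive_eq (derivM (deriv_cst (P s) t) qt) _.
    by rewrite -/q; field.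
  - by apply: is_derive_eq (derivM (dS t) qt) _; rewrite -/q; field.
have mu0 : mu lambda != 0 by rewrite mulf_neq0// expi_neq0.
apply: etrans (congr2 (fun Ms Mt => X.1%:C *: Ms + X.2%:C *: Mt) Ds Dt) _.
rewrite (PdE s t) (SdE s t) /N qq -/q [Num.sqrt _](_ : _ = q).
  exact: tau_mx_killing_real.
by rewrite -qq.
Qed.

End KillingEquation.

(** * Complex coefficients in the generated algebra *)

Section ComplexCoefficients.
Variable R : realType.
Local Notation K := R[i].
Variables V P W S : R -> R.
Local Notation in_alg := (in_alg V P W S).

(** Complex-valued functions with real and imaginary parts in the algebra, and
    matrices of such functions. *)
Definition in_calg (F : R -> R -> K) : Prop :=
  in_alg (fun s t => complex.Re (F s t)) /\
  in_alg (fun s t => complex.Im (F s t)).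

Lemma in_calg_cst z : in_calg (fun _ _ => z).
Proof. by split; apply: in_alg_cst. Qed.

Lemma in_calg_real u : in_alg u -> in_calg (fun s t => (u s t)%:C).
Proof. by move=> eu; split => //; apply: in_alg_cst. Qed.

Lemma in_calgM F G :
  in_calg F -> in_calg G -> in_calg (fun s t => F s t * G s t).
Proof.
move=> [Fr Fi] [Gr Gi]; split.
  have -> : (fun s t => complex.Re (F s t * G s t)) = (fun s t =>
      complex.Re (F s t) * complex.Re (G s t) +
      - 1 * (complex.Im (F s t) * complex.Im (G s t))).
    apply/funext => s; apply/funext => t.
    by case: (F s t) (G s t) => [? ?] [? ?] /=; ring.
  apply: in_algD; first exact: in_algM.
  by apply: in_algM (in_alg_cst _ _ _ _ _) _; apply: in_algM.
have -> : (fun s t => complex.Im (F s t * G s t)) = (fun s t =>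
    complex.Re (F s t) * complex.Im (G s t) +
    complex.Im (F s t) * complex.Re (G s t)).
  apply/funext => s; apply/funext => t.
  by case: (F s t) (G s t) => [? ?] [? ?] /=; ring.
by apply: in_algD; apply: in_algM.
Qed.

Lemma in_calgD F G :
  in_calg F -> in_calg G -> in_calg (fun s t => F s t + G s t).
Proof.
move=> [Fr Fi] [Gr Gi]; split.
  have -> : (fun s t => complex.Re (F s t + G s t)) =
    (fun s t => complex.Re (F s t) + complex.Re (G s t)).
    apply/funext => s; apply/funext => t.
    by case: (F s t) (G s t) => [? ?] [? ?].
  exact: in_algD.
have -> : (fun s t => complex.Im (F s t + G s t)) =
  (fun s t => complex.Im (F s t) + complex.Im (G s t)).
  apply/funext => s; apply/funext => t.
  by case: (F s t) (G s t) => [? ?] [? ?].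
exact: in_algD.
Qed.

Lemma in_calgN F : in_calg F -> in_calg (fun s t => - F s t).
Proof.
move=> cF; have := in_calgM (in_calg_cst (- 1)) cF.
by under eq_fun do under eq_fun do rewrite mulN1r.
Qed.

Lemma in_calgJ F : in_calg F -> in_calg (fun s t => (F s t)^*).
Proof.
move=> cF; have [_ cFi] := in_calgN cF; split.
  have -> : (fun s t => complex.Re (F s t)^*) = (fun s t => complex.Re (F s t)).
    by apply/funext => s; apply/funext => t; case: (F s t).
  by case: cF.
have -> // : (fun s t => complex.Im (F s t)^*) =
  (fun s t => complex.Im (- F s t)).
by apply/funext => s; apply/funext => t; case: (F s t).
Qed.

Definition in_mxalg (F : R -> R -> 'M[K]_3) : Prop :=
  forall i j, in_calg (fun s t => F s t i j).

Lemma in_mxalg_mx3Z z a11 a12 a13 a21 a22 a23 a31 a32 a33 :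
  in_calg a11 -> in_calg a12 -> in_calg a13 ->
  in_calg a21 -> in_calg a22 -> in_calg a23 ->
  in_calg a31 -> in_calg a32 -> in_calg a33 ->
  in_mxalg (fun s t => z *: mx3 (a11 s t) (a12 s t) (a13 s t)
    (a21 s t) (a22 s t) (a23 s t) (a31 s t) (a32 s t) (a33 s t)).
Proof.
move=> *; move=> [[|[|[|//]]] i] [[|[|[|//]]] j];
  under eq_fun do under eq_fun do rewrite !mxE/=;
  exact: in_calgM (in_calg_cst z) _.
Qed.

End ComplexCoefficients.

(** * Twisting, reality and conclusion *)

Section RealKillingField.
Variable R : realType.
Local Notation K := R[i].

Lemma addr_rev5 (G : zmodType) (x1 x2 x3 x4 x5 : G) :
  x1 + x2 + x3 + x4 + x5 = x5 + x4 + x3 + x2 + x1.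
Proof. by rewrite addrC (addrC _ x4) (addrC _ x3) (addrC x1) !addrA. Qed.

Lemma sum5 (G : zmodType) (F : 'I_5 -> G) :
  \sum_k F k = F 0 + F 1 + F 2 + F 3 + F 4.
Proof.
rewrite !big_ord_recl big_ord0 addr0 !addrA.
by congr (F _ + F _ + F _ + F _ + F _); apply/val_inj.
Qed.

(** Division of the sum of the two energies by [f = 1/6 + x + y]: it expresses
    the derivative [- x - 6 x^2] of [P] in the form used for the Killing
    equation. *)
Lemma cubic_div (x y : R) : 6^-1 + x + y != 0 ->
  - x - 6 * x ^+ 2 =
  (216^-1 - x ^+ 2 / 2 - 2 * x ^+ 3 - y ^+ 2 / 2 - 2 * y ^+ 3) /
    (6^-1 + x + y) - (6^-1 + x + y) ^+ 2 - 3 * (6^-1 + x + y) * (x - y).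
Proof.
move=> F0; have yE : y = (6^-1 + x + y) - 6^-1 - x by ring.
by move: (6^-1 + x + y) F0 yE => F F0 ->; field.
Qed.

Section KillingField.
Variables (r theta b c B C : R) (V P W S : R -> R).
Variables (g : R -> R -> K) (h : R -> R -> R).
Let f s t := 6^-1 + V s + W t.
Hypothesis r_gt0 : 0 < r.
Hypothesis VP : profile b B V P.
Hypothesis WS : profile c C W S.
Hypothesis bc : b ^+ 2 + c ^+ 2 = 216^-1.
Hypothesis r2 : r ^+ 2 = (b * B) ^+ 2 + (c * C) ^+ 2.
Hypothesis gE : forall s t,
  g s t = (Num.sqrt (f s t))^-1%:C * ('i%R * (S t)%:C - (P s)%:C).
Hypothesis hE : forall s t, h s t = V s - W t.

Let f_gt0 s t : 0 < f s t.
Proof. by apply: (profile_pos VP WS bc r2); rewrite gt_eqF. Qed.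

Local Notation eta := (tau r theta f h g).

(** The coefficient of [lambda^(k - 2)] in [tau]. *)
Definition tau_coef (k : 'I_5) (s t : R) : 'M[K]_3 :=
  nth 0 [:: taum2 r theta f s t; taum1 theta g s t; tau0 h s t;
            tau1 theta g s t; tau2 r theta f s t] k.

Lemma tau_laurent s t lambda : lambda != 0 ->
  eta s t lambda = @laurent R 2 (fun k => tau_coef k s t) lambda.
Proof.
move=> l0.
rewrite /laurent.
transitivity (\sum_(k < 5)
    [:: lambda ^- 2; lambda ^- 1; 1; lambda; lambda ^+ 2]`_k *: tau_coef k s t).
  by rewrite sum5 /tau_coef /tau /= scale1r; exact: addr_rev5.
by apply: eq_bigr => -[[|[|[|[|[|//]]]]] i] _; congr (_ *: _).
Qed.

Lemma tau_coef_in_mxalg k : in_mxalg V P W S (tau_coef k).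
Proof.
have c0 : in_calg V P W S (fun _ _ => 0) := in_calg_cst _ _ _ _ 0.
have ef : in_alg V P W S f.
  apply: in_algD (in_alg_W V P W S).
  exact: in_algD (in_alg_cst _ _ _ _ 6^-1) (in_alg_V V P W S).
have eq : in_alg V P W S (fun s t => (Num.sqrt (f s t))^-1).
  exact: in_alg_invsqrt.
have eh : in_alg V P W S h.
  have -> : h = fun s t => V s + - 1 * W t.
    by apply/funext => s; apply/funext => t; rewrite hE mulN1r.
  apply: in_algD (in_alg_V V P W S) _.
  exact: in_algM (in_alg_cst _ _ _ _ _) (in_alg_W V P W S).
have cf := in_calg_real ef.
have cp := in_calg_real (in_algM (in_alg_cst V P W S r) eq).
have c2h := in_calg_real (in_algM (in_alg_cst V P W S 2) eh).
have cNh : in_calg V P W S (fun s t => (- h s t)%:C).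
  have := in_calg_real (in_algM (in_alg_cst V P W S (- 1)) eh).
  by under eq_fun do under eq_fun do rewrite mulN1r.
have cg : in_calg V P W S g.
  have -> : g = fun s t =>
    (Num.sqrt (f s t))^-1%:C * ('i%R * (S t)%:C + - (P s)%:C).
    by apply/funext => s; apply/funext => t; rewrite gE.
  apply: in_calgM (in_calg_real eq) (in_calgD _ _).
    exact: in_calgM (in_calg_cst _ _ _ _ _) (in_calg_real (in_alg_S V P W S)).
  exact: in_calgN (in_calg_real (in_alg_P V P W S)).
case: k => [[|[|[|[|[|//]]]]] k].
- exact: (in_mxalg_mx3Z _ c0 c0 cp cp c0 c0 c0 cf c0).
- exact: (in_mxalg_mx3Z _ c0 (in_calgN (in_calgJ cg)) c0 c0 c0 c0 (in_calgJ cg)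
    c0 c0).
- exact: (in_mxalg_mx3Z _ c2h c0 c0 c0 cNh c0 c0 c0 cNh).
- exact: (in_mxalg_mx3Z _ c0 c0 cg (in_calgN cg) c0 c0 c0 c0 c0).
- exact: (in_mxalg_mx3Z _ c0 cp c0 c0 c0 cf cp c0 c0).
Qed.

Lemma tau_real_killing : real_polynomial_Killing_field r theta f eta.
Proof.
have tE s t lambda (l0 : lambda != 0) :=
  @tauE R r theta f h g P S f_gt0 gE lambda s t l0.
have Lgl s t : in_Lambda_gl 2 (eta s t).
  split.
    by exists (fun k => tau_coef k s t) => lambda; exact: tau_laurent.
  move=> lambda l0; have z0 : zeta R != 0 := expi_neq0 _.
  rewrite !tE ?mulf_neq0// -tau_mx_twist; congr tau_mx.
    by rewrite mulrA.
  by rewrite -invfM mulrA.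
exists 2%N; last first.
  move=> s t; split=> // lambda l1.
  have l0 : lambda != 0 by rewrite -normr_eq0 l1 oner_eq0.
  have lJ : lambda^*%C = lambda^-1.
    by apply: (mulfI l0); rewrite -sqr_normc l1 expr1n divff.
  have mJ : (lambda * expi (theta / 3))^*%C = (lambda * expi (theta / 3))^-1.
    have -> : (lambda * expi (theta / 3))^*%C =
      lambda^*%C * (expi (theta / 3))^*%C by exact: rmorphM.
    by rewrite lJ conjc_expi invfM.
  rewrite tE//; apply: tau_mx_skew; first exact: mJ.
  by rewrite conjc_inv mJ invrK.
split.
  split=> //; exists tau_coef; last by move=> *; exact: tau_laurent.
  move=> k i j; have [er ei] := tau_coef_in_mxalg k i j.
  by split; apply: (in_alg_smooth VP WS f_gt0).
have fs := @deriv_s_f R b B V P W VP.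
have ft := @deriv_t_f R c C V W S WS.
have dP (s : R) : is_derive s 1 P (- V s - 6 * V s ^+ 2) by case: (VP s).
have dS (s : R) : is_derive s 1 S (- W s - 6 * W s ^+ 2) by case: (WS s).
have hh : h = fun s t => V s - W t.
  by apply/funext => ?; apply/funext => ?; exact: hE.
have sumE s t : r ^+ 2 + P s ^+ 2 + S t ^+ 2 =
    216^-1 - V s ^+ 2 / 2 - 2 * V s ^+ 3 - W t ^+ 2 / 2 - 2 * W t ^+ 3.
  have [_ _ -> _] := VP s; have [_ _ -> _] := WS t.
  by rewrite r2 -bc; ring.
move=> lambda l0 s t X.
apply: (@tau_killing R r theta f h g P S r_gt0 f_gt0 fs ft gE
  (fun s => - V s - 6 * V s ^+ 2) (fun t => - W t - 6 * W t ^+ 2)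
  _ _ dP dS _ _) l0.
- move=> {}s {}t; have [dV _ _ _] := VP s; rewrite hh.
  by apply: is_derive_eq (derivB dV (deriv_cst (W t) s)) _; ring.
- move=> {}s {}t; have [dW _ _ _] := WS t; rewrite hh.
  by apply: is_derive_eq (derivB (deriv_cst (V s) t) dW) _; ring.
- move=> {}s {}t; rewrite sumE hE; apply: cubic_div.
  by rewrite gt_eqF//; exact: f_gt0.
- move=> {}s {}t; rewrite sumE hE; have F0 : f s t != 0 by rewrite gt_eqF.
  have FE : 6^-1 + W t + V s = f s t by rewrite addrAC.
  rewrite (@cubic_div (W t) (V s)) FE//; move: (f s t) F0 => F F0.
  by field.
Qed.

End KillingField.
End RealKillingField.

Theorem theorem6p4 (R : realType) (theta0 : R)
    (y z : 'I_3 -> R -> R[i]) (v w : R -> R) (B C r theta : R) :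
  0 <= theta0 < 2 * pi ->
  evolution (beta theta0) y v ->
  evolution (gamma theta0) z w ->
  (forall s, complex.Im (\prod_j y j s) = B) ->
  (forall t, complex.Im (\prod_j z j t) = C) ->
  let a : R := 6^-1 in
  let b : R := - 2^-1 * \prod_j beta theta0 j in
  let c : R := - 2^-1 * \prod_j gamma theta0 j in
  let xi : R[i] := (c * C)%:C + 'i * (b * B)%:C in
  xi != 0 ->
  0 < r ->
  xi = r%:C * expi theta ->
  let f := fun s t : R => a + b * v s + c * w t in
  let g := fun s t : R =>
    ((2 * Num.sqrt (f s t))^-1)%:C *
      ((- b * derive1 v s)%:C + 'i * (c * derive1 w t)%:C) in
  let h := fun s t : R =>
    (12 * f s t)^-1 * (- b * derive1n 2 v s + c * derive1n 2 w t) in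
  real_polynomial_Killing_field r theta f (tau r theta f h g).
Proof.
move=> _ yv zw yB zC a b c xi _ r0 xiE f g h.
have [dv dp VP] := evolution_profile (balanced_beta theta0) yv yB.
have [dw dq WS] := evolution_profile (balanced_gamma theta0) zw zC.
rewrite -/b in dp VP; rewrite -/c in dq WS.
have bc : b ^+ 2 + c ^+ 2 = 216^-1 := sqr_prod_betaDgamma theta0.
have r2 : r ^+ 2 = (b * B) ^+ 2 + (c * C) ^+ 2.
  (* Compare real and imaginary parts of the two expressions of xi. *)
  have : xi = (c * C) +i* (b * B).
    rewrite /xi -complexiE; apply/eqP.
    by rewrite eq_complex /=; apply/andP; split; apply/eqP; ring.
  rewrite xiE /expi => -[].
  rewrite !mul0r subr0 addr0 => <- <-.
  by rewrite !exprMn -mulrDr addrC cos2Dsin2 mulr1.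
have f0 s t : 0 < f s t.
  by apply: (profile_pos VP WS bc r2); rewrite gt_eqF.
have v1 : derive1 v = fun s => 2 * complex.Re (\prod_j y j s).
  by apply/funext => s; rewrite derive1E (@derive_val _ _ _ _ _ _ _ (dv s)).
have w1 : derive1 w = fun t => 2 * complex.Re (\prod_j z j t).
  by apply/funext => t; rewrite derive1E (@derive_val _ _ _ _ _ _ _ (dw t)).
apply: (tau_real_killing theta r0 VP WS bc r2) => s t.
  rewrite /g v1 w1 -/(f s t) invfM -complexiE.
  move: (Num.sqrt (f s t))^-1 => k; apply/eqP.
  by rewrite eq_complex /=; apply/andP; split; apply/eqP; field.
rewrite /h /derive1n /= v1 w1 !derive1E.
rewrite (@derive_val _ _ _ _ _ _ _ (derivZ 2 (dp s))).
rewrite (@derive_val _ _ _ _ _ _ _ (derivZ 2 (dq t))).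
have f0' : f s t != 0 by rewrite gt_eqF.
apply: (mulfI f0').
(* Twelve times f h is 2 (V - W) (1 + 6 (V + W)). *)
transitivity (12^-1 * (- b * (2 * (- v s - 6 * b * v s ^+ 2)) +
   c * (2 * (- w t - 6 * c * w t ^+ 2)))); last by rewrite /f /a; field.
by move: (f s t) f0' => F F0; field.
Qed.
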